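(* Let $(S,\otimes,\mathbf{1})$ be a monoid. In a finger B-tree with aggregates that contains $\langle t_1,v_1\rangle,\ldots,\langle t_n,v_n\rangle$ (with $t_1<\dots<t_n$), the operation query$()$ returns $v_1\otimes\cdots\otimes v_n$.
   Context: A monoid is a triple $(S,\otimes,\mathbf{1})$ with $\otimes$ associative (not necessarily commutative or invertible) and identity $\mathbf{1}$. A finger B-tree with aggregates with parameter $\mu\geq 2$ (MIN_ARITY $=\mu$, MAX_ARITY $=2\mu$) is a search tree keyed by timestamps from a totally ordered set: each node $y$ has arity $a=a(y)$, stores $a-1$ time-ordered pairs $\langle t_0,v_0\rangle,\dots,\langle t_{a-2},v_{a-2}\rangle$ and, if it is not a leaf, children $z_0,\dots,z_{a-1}$, with all timestamps in the subtree of $z_j$ lying between $t_{j-1}$ and $t_j$; all leaves have the same depth; non-root nodes satisfy $\mu\le a\le 2\mu$ and the root $2\le a\le 2\mu$; each node has a parent pointer, and there are pointers (fingers) to the leftmost leaf (left finger) and rightmost leaf (right finger). The left spine is the root-to-left-finger path, the right spine the root-to-right-finger path. The contents of the tree are all its pairs in time order. For a node $y$ define the up-aggregate $\Pi_\uparrow(y)=\Pi_\uparrow(z_0)\otimes v_0\otimes\Pi_\uparrow(z_1)\otimes\cdots\otimes v_{a-2}\otimes\Pi_\uparrow(z_{a-1})$ (for a leaf, $v_0\otimes\cdots\otimes v_{a-2}$). Aggregation invariants: (i) the root stores the inner aggregate, which is $v_0\otimes\cdots\otimes v_{a-2}$ if the root is a leaf and otherwise $v_0\otimes\Pi_\uparrow(z_1)\otimes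 v_1\otimes\cdots\otimes\Pi_\uparrow(z_{a-2})\otimes v_{a-2}$ (everything except the subtrees of its leftmost and rightmost children); (ii) each non-root node $y$ on the left spine stores the left aggregate $\Pi_\swarrow(y)=v_0\otimes\Pi_\uparrow(z_1)\otimes v_1\otimes\cdots\otimes v_{a-2}\otimes\Pi_\uparrow(z_{a-1})\otimes\Pi_\swarrow(\mathrm{parent}(y))$, where the child factors are absent for a leaf and the last factor is absent if the parent is the root (so it is the aggregate of the subtree of the root's leftmost child except the subtree of $z_0$); (iii) symmetrically each non-root node $y$ on the right spine stores $\Pi_\searrow(y)=\Pi_\searrow(\mathrm{parent}(y))\otimes\Pi_\uparrow(z_0)\otimes v_0\otimes\cdots\otimes\Pi_\uparrow(z_{a-2})\otimes v_{a-2}$ (last-parent factor absent if the parent is the root, child factors absent for a leaf); (iv) every other node stores $\Pi_\uparrow(y)$. The operation query$()$ returns the root's stored aggregate if the root is a leaf, and otherwise (left finger's stored aggregate) $\otimes$ (root's stored aggregate) $\otimes$ (right finger's stored aggregate). *)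

(* Defs.v *)
From mathcomp Require Import all_boot all_order.

Set Implicit Arguments.
Unset Strict Implicit.
Unset Printing Implicit Defensive.

(* A node carries its stored aggregate, its timestamp/value pairs, and its
   children; a leaf is a node without children. *)
Inductive node (T S : Type) : Type :=
  Node of S & seq (T * S) & seq (node T S).

Section Nodes.

Variables T S : Type.
Implicit Types y z r : node T S.

Definition agg y : S := let: Node x _ _ := y in x.
Definition pairs y : seq (T * S) := let: Node _ ps _ := y in ps.
Definition children y : seq (node T S) := let: Node _ _ zs := y in zs.
Definition keys y : seq T := [seq tv.1 | tv <- pairs y].
Definition vals y : seq S := [seq tv.2 | tv <- pairs y].
Definition is_leaf y : bool := nilp (children y).
Definition arity y : nat := (size (pairs y)).+1.

(* Pointers to nodes are addresses relative to the root.  An address lists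
   child indices from the node UP to the root: [::] is the root, and j :: q is
   child number j of the node at q.  Thus the parent pointer of j :: q is q,
   the depth of a node is the size of its address, and the nodes on the path
   from the root to p are those whose address is a suffix of p. *)
Definition addr := seq nat.

Fixpoint node_at r (p : addr) : option (node T S) :=
  if p is j :: q then obind (fun y => onth (children y) j) (node_at r q)
  else Some r.

Definition contains r (k : T) (x : S) : Prop :=
  exists (p : addr) (y : node T S) (i : nat),
    node_at r p = Some y /\ onth (pairs y) i = Some (k, x).

Fixpoint last_child_path r (p : addr) : bool :=
  if p is j :: q then
    last_child_path r q &&
    (if node_at r q is Some y then j.+1 == size (children y) else false)
  else true.

Definition leaf_at r (p : addr) : bool :=
  if node_at r p is Some y then is_leaf y else false.

Definition leftmost_leaf r p := all (pred1 0) p && leaf_at r p.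
Definition rightmost_leaf r p := last_child_path r p && leaf_at r p.

End Nodes.

Record finger_tree (T S : Type) := FingerTree {
  tree_root : node T S;
  left_finger : addr;
  right_finger : addr
}.

Definition search_node (d : Order.disp_t) (T : orderType d) (S : Type)
    (y : node T S) : Prop :=
  sorted <%O (keys y) /\
  forall j z k x, onth (children y) j = Some z -> contains z k x ->
    (forall i k', j = i.+1 -> onth (keys y) i = Some k' -> (k' < k)%O) /\
    (forall k', onth (keys y) j = Some k' -> (k < k')%O).

Record is_finger_btree (d : Order.disp_t) (T : orderType d) (S : Type)
    (mu : nat) (F : finger_tree T S) : Prop := IsFingerBTree {
  fbt_children : forall p y, node_at (tree_root F) p = Some y ->
    is_leaf y \/ size (children y) = arity y;
  fbt_search : forall p y, node_at (tree_root F) p = Some y -> search_node y;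
  fbt_depth : forall p q, leaf_at (tree_root F) p -> leaf_at (tree_root F) q ->
    size p = size q;
  fbt_arity : forall p y, p <> [::] -> node_at (tree_root F) p = Some y ->
    mu <= arity y <= mu.*2;
  fbt_root_arity : 2 <= arity (tree_root F) <= mu.*2;
  fbt_left : leftmost_leaf (tree_root F) (left_finger F);
  fbt_right : rightmost_leaf (tree_root F) (right_finger F)
}.

Definition on_left_spine (T S : Type) (F : finger_tree T S) (p : addr) :=
  suffix p (left_finger F).

Definition on_right_spine (T S : Type) (F : finger_tree T S) (p : addr) :=
  suffix p (right_finger F).

(* interleave [:: x0; x1; ...] [:: y0; y1; ...] = [:: x0; y0; x1; y1; ...];
   once one list is exhausted, the rest of the other one is appended. *)
Fixpoint interleave (A : Type) (xs ys : seq A) : seq A :=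
  match xs, ys with
  | x :: xs', y :: ys' => x :: y :: interleave xs' ys'
  | [::], _ => ys
  | _, [::] => xs
  end.

Section Aggregates.

Variables (T S : Type) (idm : S) (op : Monoid.law idm).
Implicit Types (y r : node T S) (F : finger_tree T S).

Definition mprod (xs : seq S) : S := \big[op/idm]_(x <- xs) x.

(* With a = arity y and u_j the up-aggregate of child z_j, the four products
   below are over the factors
     up_agg     : u_0, v_0, u_1, ..., v_{a-2}, u_{a-1}
     inner_agg  :      v_0, u_1, ..., u_{a-2}, v_{a-2}
     left_part  :      v_0, u_1, ..., v_{a-2}, u_{a-1}
     right_part : u_0, v_0, ..., u_{a-2}, v_{a-2}
   and over v_0, ..., v_{a-2} when y is a leaf. *)
Fixpoint up_agg y : S :=
  let: Node _ ps zs := y in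
  mprod (interleave [seq up_agg z | z <- zs] [seq tv.2 | tv <- ps]).

Definition child_aggs y : seq S := [seq up_agg z | z <- children y].

Definition inner_agg y : S :=
  mprod (interleave (vals y) (behead (take (arity y).-1 (child_aggs y)))).

Definition left_part y : S :=
  mprod (interleave (vals y) (behead (child_aggs y))).

Definition right_part y : S :=
  mprod (interleave (take (arity y).-1 (child_aggs y)) (vals y)).

(* Only meaningful for p the address of a non-root node; the value idm is a
   default for the other cases. *)
Fixpoint left_agg r (p : addr) : S :=
  let own := if node_at r p is Some y then left_part y else idm in
  match p with
  | [::] => idm
  | [:: _] => own
  | _ :: q => op own (left_agg r q)
  end.

Fixpoint right_agg r (p : addr) : S :=
  let own := if node_at r p is Some y then right_part y else idm in
  match p with
  | [::] => idm
  | [:: _] => own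
  | _ :: q => op (right_agg r q) own
  end.

Record aggregation_invariants F : Prop := AggregationInvariants {
  agg_root : agg (tree_root F) = inner_agg (tree_root F);
  agg_left : forall p y, p <> [::] -> node_at (tree_root F) p = Some y ->
    on_left_spine F p -> agg y = left_agg (tree_root F) p;
  agg_right : forall p y, p <> [::] -> node_at (tree_root F) p = Some y ->
    on_right_spine F p -> agg y = right_agg (tree_root F) p;
  agg_other : forall p y, p <> [::] -> node_at (tree_root F) p = Some y ->
    ~~ on_left_spine F p -> ~~ on_right_spine F p -> agg y = up_agg y
}.

(* None only arises when a finger does not point to a node. *)
Definition query F : option S :=
  if is_leaf (tree_root F) then Some (agg (tree_root F))
  else if node_at (tree_root F) (left_finger F) is Some l then
    if node_at (tree_root F) (right_finger F) is Some r then
      Some (op (op (agg l) (agg (tree_root F))) (agg r))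
    else None
  else None.

End Aggregates.

(* Main.v *)
Require Import Defs.
From mathcomp Require Import all_boot all_order.
From Stdlib Require List.

(** The in-order list of pairs of the tree is strictly sorted by timestamp, so
    it is the list of the given pairs, and the up-aggregate of the root is its
    product.  Going down the left spine, the up-aggregate of the root's first
    child factors at each node as (first child of the node) times (left
    aggregate of the node); at the left finger the first factor is empty, so
    the finger stores the up-aggregate of the root's whole first subtree.  The
    right finger is symmetric, and the inner aggregate fills the gap. *)

Set Implicit Arguments.
Unset Strict Implicit.
Unset Printing Implicit Defensive.

Import Order.TTheory.

(** * Interleavings, and membership without decidable equality *)

Section Sequences.

Variable A : Type.
Implicit Types (a : A) (s xs ys : seq A).

Lemma interleave_nilr xs : interleave xs [::] = xs.
Proof. by case: xs. Qed.

(** Peels the first child's aggregate off an up-aggregate, leaving the list that [left_part]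
    multiplies. *)
Lemma interleave_cons a xs ys :
  interleave (a :: xs) ys = a :: interleave ys xs.
Proof.
elim: xs ys a => [|x xs IH] [|y ys] a //=.
by have /= -> := IH ys x.
Qed.

(** Isolates the last child of an inner node, which has one more child than pairs. *)
Lemma interleave_take xs ys : size ys <= size xs ->
  interleave xs ys = interleave (take (size ys) xs) ys ++ drop (size ys) xs.
Proof.
elim: ys xs => [|y ys IH] [|x xs] //=.
by rewrite ltnS => /IH ->.
Qed.

Lemma map_interleave B (f : A -> B) xs ys :
  map f (interleave xs ys) = interleave (map f xs) (map f ys).
Proof. by elim: xs ys => [|x xs IH] [|y ys] //=; rewrite IH. Qed.

(** Values lack decidable equality, so membership of pairs is [List.In] rather than [\in]. *)
Lemma In_interleave a xs ys :
  List.In a (interleave xs ys) <-> List.In a xs \/ List.In a ys.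
Proof.
elim: xs ys => [|x xs IH] [|y ys] /=; try tauto.
by rewrite IH; tauto.
Qed.

Lemma In_flatten a (ss : seq (seq A)) :
  List.In a (flatten ss) <-> exists2 s, List.In s ss & List.In a s.
Proof.
elim: ss => [|s ss IH] /=; first by split=> // -[].
rewrite List.in_app_iff IH; split.
  by move=> [as_|[s' ? ?]]; [exists s|exists s'] => //; [left|right].
by move=> [s' [<-|s's]] as'; [left|right; exists s'].
Qed.

Lemma In_onth a s : List.In a s <-> exists i, onth s i = Some a.
Proof.
elim: s => [|b s IH] /=; first by split=> // -[] [].
rewrite IH; split.
  by move=> [->|[i ?]]; [exists 0|exists i.+1].
by move=> [[[->]|i ?]]; [left|right; exists i].
Qed.

End Sequences.

Lemma In_mem_map (A : Type) (B : eqType) (f : A -> B) (a : A) (s : seq A) :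
  List.In a s -> f a \in map f s.
Proof.
elim: s => //= b s IH [->|/IH]; rewrite inE ?eqxx // => ->.
by rewrite orbT.
Qed.

(** * Strictly sorted key lists *)

Section SortedSequences.

Variables (d : Order.disp_t) (T : orderType d).

(** A strictly sorted list repeats no key and starts with its least one, so its set of entries
    determines it head by head. *)
Lemma eq_In_sorted_keys (S : Type) (s1 s2 : seq (T * S)) :
  sorted <%O (map fst s1) -> sorted <%O (map fst s2) ->
  (forall a, List.In a s1 <-> List.In a s2) -> s1 = s2.
Proof.
elim: s1 s2 => [|a s1 IH] [|b s2] //= => [_ _ /(_ b)|_ _ /(_ a)|].
- by move=> [_ b_nil]; case: b_nil; left.
- by move=> [a_nil _]; case: a_nil; left.
move=> p1 p2 eq12.
have gt_head (c x : T * S) s : path <%O c.1 (map fst s) -> List.In x s -> (c.1 < x.1)%O.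
  by move=> /(order_path_min lt_trans)/allP min_c /(In_mem_map fst); apply: min_c.
(* Otherwise each head lies in the tail of the other list, so each key is below the other. *)
have eq_ab : a = b.
  have [//|/(gt_head _ _ _ p2) lt_ba] := (eq12 a).1 (or_introl erefl).
  have [//|/(gt_head _ _ _ p1) lt_ab] := (eq12 b).2 (or_introl erefl).
  by have := lt_trans lt_ab lt_ba; rewrite ltxx.
case: _ / eq_ab in p2 eq12 *; congr (_ :: _).
apply: IH => [||x]; [exact: path_sorted p1|exact: path_sorted p2|].
have not_head s : path <%O a.1 (map fst s) -> ~ List.In a s.
  by move=> ps /(gt_head _ _ _ ps); rewrite ltxx.
split=> xs.
  have [ax|//] := (eq12 x).1 (or_intror xs).
  by case: (not_head _ p1); rewrite ax.
have [ax|//] := (eq12 x).2 (or_intror xs).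
by case: (not_head _ p2); rewrite ax.
Qed.

(** [k0] stands for the key left of the first block, so that every block has a lower bound and the
    induction on [ks] goes through. *)
Lemma path_flatten_interleave (k0 : T) (ks : seq T) (cs : seq (seq T)) :
  size cs = (size ks).+1 -> path <%O k0 ks ->
  (forall j c, onth cs j = Some c -> sorted <%O c) ->
  (forall j c k k', onth cs j = Some c -> k \in c ->
    onth (k0 :: ks) j = Some k' -> (k' < k)%O) ->
  (forall j c k k', onth cs j = Some c -> k \in c ->
    onth ks j = Some k' -> (k < k')%O) ->
  path <%O k0 (flatten (interleave cs [seq [:: k] | k <- ks])).
Proof.
elim: ks k0 cs => [|k ks IH] k0 [|c cs] //= [sz_cs] pk srt lo up.
  case: cs sz_cs {srt up} (srt 0 c erefl) lo => //= _ srt_c lo.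
  rewrite cats0 (path_sortedE lt_trans) srt_c andbT.
  by apply/allP => x xc; apply: (lo 0 c).
have /andP[lt_k0k pks] := pk.
rewrite cat_path (path_sortedE lt_trans) (srt 0 c erefl) andbT /=.
apply/and3P; split.
- by apply/allP => x xc; apply: (lo 0 c).
(* The entry just before [k] is [k0] when [c] is empty, else the last entry of [c]. *)
- case: (lastP c) up => [|c' x] // up; rewrite last_rcons.
  by apply: (up 0 (rcons c' x)); rewrite // mem_rcons mem_head.
- apply: IH => //.
  + by move=> j c' cj; apply: (srt j.+1).
  + by move=> j c' x k' cj xc' kj; apply: (lo j.+1 c').
  + by move=> j c' x k' cj xc' kj; apply: (up j.+1 c').
Qed.

(** The leftmost block has no lower bound, so the previous lemma is applied from the first key on
    and that block is prepended separately. *)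
Lemma sorted_flatten_interleave (ks : seq T) (cs : seq (seq T)) :
  size cs = (size ks).+1 -> sorted <%O ks ->
  (forall j c, onth cs j = Some c -> sorted <%O c) ->
  (forall j c k k', onth cs j.+1 = Some c -> k \in c ->
    onth ks j = Some k' -> (k' < k)%O) ->
  (forall j c k k', onth cs j = Some c -> k \in c ->
    onth ks j = Some k' -> (k < k')%O) ->
  sorted <%O (flatten (interleave cs [seq [:: k] | k <- ks])).
Proof.
case: ks cs => [|k ks] [|c cs] //= [sz_cs] pk srt lo up.
  by case: cs sz_cs {lo up} srt => //= _ /(_ 0 c erefl); rewrite cats0.
have path_k : path <%O k (flatten (interleave cs [seq [:: x] | x <- ks])).
  apply: path_flatten_interleave => //.
  + by move=> j c' cj; apply: (srt j.+1).
  + by move=> j c' x k' cj xc' kj; apply: (up j.+1 c').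
case: c srt lo up => //= x c srt lo up.
rewrite cat_path /= path_k andbT.
apply/andP; split; first exact: (srt 0 (x :: c)).
by apply: (up 0 (x :: c)); rewrite ?mem_last.
Qed.

End SortedSequences.

(** * The in-order traversal and its relation to addresses *)

Section Contents.

Variables T S : Type.
Implicit Types (y z r : node T S) (p q : addr).

Lemma node_induction (P : node T S -> Prop) :
  (forall x ps zs, (forall z, List.In z zs -> P z) -> P (Node x ps zs)) ->
  forall y, P y.
Proof.
move=> IH; fix rec 1 => -[x ps zs]; apply: IH.
by elim: zs => [z []|z zs IHzs z' [<-|/IHzs]]; last exact; exact: rec.
Qed.

Fixpoint contents y : seq (T * S) :=
  let: Node _ ps zs := y in
  flatten (interleave [seq contents z | z <- zs] [seq [:: tv] | tv <- ps]).

Lemma node_at_cat r p q :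
  node_at r (p ++ q) = obind (fun y => node_at y p) (node_at r q).
Proof.
elim: p => [|j p IH] /=; first by case: (node_at r q).
by rewrite IH; case: (node_at r q).
Qed.

(** Addresses run upwards, so the last entry is the first step down from the root; induction on the
    tree splits addresses there. *)
Lemma node_at_rcons r p j :
  node_at r (rcons p j) = obind (fun y => node_at y p) (onth (children r) j).
Proof. by rewrite -cats1 node_at_cat. Qed.

Lemma In_contents x ps zs (a : T * S) :
  List.In a (contents (Node x ps zs)) <->
  List.In a ps \/ exists2 z, List.In z zs & List.In a (contents z).
Proof.
rewrite /= In_flatten; split.
  move=> [s /In_interleave[]/List.in_map_iff[b [<- bs]] a_s].
    by right; exists b.
  by left; case: a_s => [<-|].
move=> [ap|[z zz az]].
  exists [:: a]; last by left.
  by apply/In_interleave; right; apply/List.in_map_iff; exists a.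
exists (contents z) => //.
by apply/In_interleave; left; apply/List.in_map_iff; exists z.
Qed.

Lemma containsP y k x : contains y k x <-> List.In (k, x) (contents y).
Proof.
elim/node_induction: y => b ps zs IH; rewrite In_contents; split.
  move=> [p [z [i []]]]; case: (lastP p) => [[<-] /= ai|{}p j].
    by left; apply/In_onth; exists i.
  rewrite node_at_rcons /=; case zj: (onth zs j) => [z'|] //= pz ai; right.
  have zz' : List.In z' zs by apply/In_onth; exists j.
  by exists z' => //; apply/IH => //; exists p, z, i.
move=> [/In_onth[i ai]|[z zz /(IH z zz)[p [z' [i [pz' ai]]]]]].
  by exists [::], (Node b ps zs), i.
have /In_onth[j zj] := zz.
by exists (rcons p j), z', i; rewrite node_at_rcons /= zj.
Qed.

End Contents.

(** Both hypotheses pass to child [j] through the addresses [rcons p j], and [search_node] at [y]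
    itself bounds the children's blocks by the keys of [y]. *)
Lemma contents_sorted (d : Order.disp_t) (T : orderType d) (S : Type)
    (y : node T S) :
  (forall p z, node_at y p = Some z ->
    is_leaf z \/ size (children z) = arity z) ->
  (forall p z, node_at y p = Some z -> search_node z) ->
  sorted <%O (map fst (contents y)).
Proof.
elim/node_induction: y => b ps zs IH shape search.
have [/= srt_ps bounds] := search [::] _ erefl.
rewrite /= map_flatten map_interleave -!map_comp.
have -> : [seq (map fst \o (fun tv : T * S => [:: tv])) tv | tv <- ps] =
          [seq [:: k] | k <- map fst ps] by rewrite -map_comp.
have [/nilP/= ->|/= sz_zs] := shape [::] _ erefl.
  by rewrite /= flatten_seq1.
have child j c : onth [seq (map fst \o @contents T S) z | z <- zs] j = Some c ->
    exists2 z, onth zs j = Some z & c = map fst (contents z).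
  by rewrite onth_map; case: (onth zs j) => //= z [<-]; exists z.
have child_key z k : k \in map fst (contents z) -> exists x, contains z k x.
  move=> /onthP[i]; rewrite onth_map; case ki: (onth _ i) => [[k' x]|] //= [<-].
  by exists x; apply/containsP/In_onth; exists i.
apply: sorted_flatten_interleave => //.
- by rewrite !size_map sz_zs.
- move=> j c /child[z zj ->].
  apply: IH => [|p z' pz'|p z' pz']; first by apply/In_onth; exists j.
    by apply: (shape (rcons p j)); rewrite node_at_rcons /= zj.
  by apply: (search (rcons p j)); rewrite node_at_rcons /= zj.
- move=> j c k k' /child[z zj ->] /child_key[x zk] kj.
  by have [lo _] := bounds _ _ _ _ zj zk; apply: lo kj.
- move=> j c k k' /child[z zj ->] /child_key[x zk] kj.
  by have [_ up] := bounds _ _ _ _ zj zk; apply: up kj.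
Qed.

(** * Factorizations of the up-aggregate *)

Section AggregateProducts.

Variables (T S : Type) (idm : S) (op : Monoid.law idm).
Implicit Types (y z r : node T S) (p q : addr).
Local Notation mprod := (mprod op).
Local Notation up_agg := (@up_agg T S idm op).

Lemma mprod_cat (s1 s2 : seq S) : mprod (s1 ++ s2) = op (mprod s1) (mprod s2).
Proof. exact: big_cat. Qed.

Lemma mprod_seq1 (x : S) : mprod [:: x] = x.
Proof. exact: big_seq1. Qed.

Lemma mprod_flatten (ss : seq (seq S)) : mprod (flatten ss) = mprod (map mprod ss).
Proof. by rewrite /Defs.mprod big_flatten big_map. Qed.

Lemma up_agg_contents y : up_agg y = mprod (map snd (contents y)).
Proof.
elim/node_induction: y => b ps zs IH.
rewrite /= map_flatten mprod_flatten !map_interleave -!map_comp.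
congr (mprod (interleave _ _)); last first.
  by apply: eq_map => tv /=; rewrite mprod_seq1.
elim: zs IH => //= z zs IHzs IH; rewrite IHzs ?IH //; first by left.
by move=> z' z'zs; apply: IH; right.
Qed.

Lemma up_agg_interleave y : up_agg y = mprod (interleave (child_aggs op y) (vals y)).
Proof. by case: y. Qed.

(** [take 1] yields the first child's factor at an inner node and the empty product at a leaf, so
    both cases share one formula. *)
Lemma up_agg_left y :
  up_agg y = op (mprod (take 1 (child_aggs op y))) (left_part op y).
Proof.
rewrite up_agg_interleave /left_part; case: (child_aggs op y) => [|u us].
  by rewrite /= interleave_nilr /Defs.mprod big_nil Monoid.mul1m.
by rewrite interleave_cons /= take0 -mprod_cat.
Qed.

(** The dropped prefix leaves exactly the last child at an inner node, and nothing at a leaf. *)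
Lemma up_agg_right y : is_leaf y \/ size (children y) = arity y ->
  up_agg y = op (right_part op y) (mprod (drop (arity y).-1 (child_aggs op y))).
Proof.
rewrite up_agg_interleave /right_part => -[/nilP leaf_y|sz_y].
  by rewrite /child_aggs leaf_y /= {3}/Defs.mprod big_nil Monoid.mulm1.
rewrite interleave_take ?mprod_cat ?size_map //.
by rewrite sz_y /arity.
Qed.

(** Arity at least 2 puts the first child among those kept by [right_part], so it can be split
    off. *)
Lemma right_part_root y : 2 <= arity y -> size (children y) = arity y ->
  right_part op y = op (mprod (take 1 (child_aggs op y))) (inner_agg op y).
Proof.
rewrite /right_part /inner_agg => ar_y sz_y.
have : size (child_aggs op y) = arity y by rewrite size_map.
case: (arity y) ar_y => [|[|m]] // _; case: (child_aggs op y) => [|u us] // _.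
by rewrite [take m.+2.-1 _]/= interleave_cons /= take0 -mprod_cat.
Qed.

(** First child times left part is the node's up-aggregate, and the node is its parent's first
    child; hence the product does not change when climbing the spine. *)
Lemma left_spine_agg r p y : p <> [::] -> all (pred1 0) p ->
  node_at r p = Some y ->
  op (mprod (take 1 (child_aggs op y))) (left_agg op r p) =
  mprod (take 1 (child_aggs op r)).
Proof.
have first_child y' z : onth (children y') 0 = Some z ->
    mprod (take 1 (child_aggs op y')) = up_agg z.
  rewrite /child_aggs; case: (children y') => //= z' zs [<-].
  by rewrite take0 mprod_seq1.
elim: p y => // j q IH y _ /= /andP[/eqP -> q0].
case rq: (node_at r q) => [y'|] //= y'y.
(* For [q = [::]] the parent is the root, where [left_agg] stops without a parent factor. *)
case: q => [|i q] in IH q0 rq *.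
  by case: rq y'y => <- y'y; rewrite /= y'y -up_agg_left (first_child _ _ y'y).
rewrite -(IH y') // (first_child _ _ y'y) up_agg_left -Monoid.mulmA.
by rewrite /= in rq *; rewrite rq /= y'y.
Qed.

Lemma right_spine_agg r p y :
  (forall q z, node_at r q = Some z -> is_leaf z \/ size (children z) = arity z) ->
  p <> [::] -> last_child_path r p -> node_at r p = Some y ->
  op (right_agg op r p) (mprod (drop (arity y).-1 (child_aggs op y))) =
  mprod (drop (arity r).-1 (child_aggs op r)).
Proof.
move=> shape.
have last_child q y' z j : node_at r q = Some y' -> j.+1 = size (children y') ->
    onth (children y') j = Some z ->
    mprod (drop (arity y').-1 (child_aggs op y')) = up_agg z.
  move=> /shape[/nilP -> //|sz_y'] sz_j zj.
  (* The right spine descends to the last child, whose index is the arity minus one. *)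
  have jE : (arity y').-1 = j by rewrite -sz_y' -sz_j.
  rewrite jE /child_aggs -map_drop (drop_nth z) -?sz_j // (onth_nth _ _ _ _ zj) /=.
  by rewrite drop_oversize -?sz_j // mprod_seq1.
elim: p y => // j q IH y _ /= /andP[lq].
case rq: (node_at r q) => [y'|] //= /eqP sz_j y'y.
have shape_y : is_leaf y \/ size (children y) = arity y.
  by apply: (shape (j :: q)); rewrite /= rq.
case: q => [|i q] in IH lq rq *.
  have -> : r = y' by case: rq.
  by rewrite /= y'y -up_agg_right // (last_child [::] y' y j).
rewrite -(IH y') // (last_child _ _ _ _ rq sz_j y'y) up_agg_right //.
by rewrite Monoid.mulmA /= in rq *; rewrite rq /= y'y.
Qed.

End AggregateProducts.

(** * The value returned by the query *)

Lemma query_up_agg (d : Order.disp_t) (T : orderType d) (S : Type) (idm : S)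
    (op : Monoid.law idm) (mu : nat) (F : finger_tree T S) :
  is_finger_btree mu F -> aggregation_invariants op F ->
  query op F = Some (up_agg op (tree_root F)).
Proof.
case: F => r lf rf [/= shape _ _ _ /andP[ar_r _] left_lf right_rf].
move=> [/= aggr aggL aggR _]; rewrite /query /=.
case: ifP => [/nilP leaf_r|/negP nleaf_r].
  rewrite aggr up_agg_interleave /inner_agg /child_aggs leaf_r /=.
  by rewrite interleave_nilr.
have sz_r : size (children r) = arity r by case: (shape [::] r erefl).
(* Fingers point to leaves and the root is not one, so the spine lemmas apply. *)
have lf0 : lf <> [::] by move=> lfE; move: left_lf; rewrite lfE.
have rf0 : rf <> [::] by move=> rfE; move: right_rf; rewrite rfE.
have leaf_aggs z : is_leaf z -> child_aggs op z = [::].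
  by move=> /nilP leaf_z; rewrite /child_aggs leaf_z.
move: left_lf right_rf => /andP[zeros leafl] /andP[lasts leafr].
move: leafl leafr; rewrite /leaf_at.
case lfE: (node_at r lf) => [l|] // /leaf_aggs leafl.
case rfE: (node_at r rf) => [y|] // /leaf_aggs leafr.
have aggl := left_spine_agg op lf0 zeros lfE.
have aggy := right_spine_agg op shape rf0 lasts rfE.
(* A leaf has no child factor, so the left aggregate at the finger is the up-aggregate of the root's
   whole first subtree. *)
rewrite leafl {1}/mprod big_nil Monoid.mul1m in aggl.
rewrite leafr {1}/mprod big_nil Monoid.mulm1 in aggy.
rewrite (aggL _ _ lf0 lfE) ?(aggR _ _ rf0 rfE) ?aggr; try exact: suffix_refl.
rewrite up_agg_right ?right_part_root //; last by right.
by rewrite aggl aggy.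
Qed.

Theorem theorem3p3 (d : Order.disp_t) (T : orderType d)
    (S : Type) (idm : S) (op : Monoid.law idm)
    (mu : nat) (hmu : 2 <= mu)
    (F : finger_tree T S)
    (hF : is_finger_btree mu F)
    (hagg : aggregation_invariants op F)
    (n : nat) (t : 'I_n -> T) (v : 'I_n -> S)
    (ht : forall i j : 'I_n, i < j -> (t i < t j)%O)
    (hc : forall (k : T) (x : S),
        contains (tree_root F) k x <-> exists i : 'I_n, t i = k /\ v i = x) :
  query op F = Some (\big[op/idm]_(i < n) v i).
Proof.
have contentsE : contents (tree_root F) = [seq (t i, v i) | i <- enum 'I_n].
  apply: eq_In_sorted_keys.
  - by apply: contents_sorted; [apply: fbt_children hF|apply: fbt_search hF].
  (* [ht] carries the increasing enumeration of indices to increasing timestamps. *)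
  - rewrite -map_comp; apply: (homo_sorted (e := fun i j : 'I_n => i < j)) => //.
    by rewrite -(sorted_map (f := val) (e' := ltn)) val_enum_ord iota_ltn_sorted.
  - move=> [k x]; rewrite -containsP hc List.in_map_iff; split.
      move=> [i [<- <-]]; exists i; split=> //; apply/In_onth/onthP.
      exact: mem_enum.
    by move=> [i [[<- <-] _]]; exists i.
rewrite (query_up_agg hF hagg) up_agg_contents contentsE -map_comp.
(* The big product ranges over [index_enum], unlocked here to match [enum 'I_n]. *)
by rewrite /mprod big_map [index_enum _]unlock enumT.
Qed.
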